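(* Let $R$ be an integral domain with $\operatorname{char} R\neq 2$ and let $\mathcal{A}$ be a central real hyperplane arrangement in $\mathbb{R}^\ell$. (1) Via the identifications below, there are natural inclusions $$\mathrm{Aut}_{\mathsf{graph}}(\mathrm{Tope}(\mathcal{A}))\subseteq\mathrm{Aut}_{\mathsf{filt}}(\mathrm{VG}(\mathcal{A})_R)\subseteq\mathrm{Aut}_{\mathsf{set}}(\mathrm{ch}(\mathcal{A}));$$ in particular $\mathrm{Aut}_{\mathsf{filt}}(\mathrm{VG}(\mathcal{A})_R)$ is finite. (2) If $\mathcal{A}$ is generic in codimension $2$, then $\mathrm{Aut}_{\mathsf{graph}}(\mathrm{Tope}(\mathcal{A}))=\mathrm{Aut}_{\mathsf{filt}}(\mathrm{VG}(\mathcal{A})_R)$.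
   Context: $\mathcal{A}=\{H_1,\dots,H_n\}$ is a finite set of distinct linear hyperplanes in $\mathbb{R}^\ell$, $H_i=\alpha_i^{-1}(0)$; $\mathrm{ch}(\mathcal{A})$ is the set of connected components of the complement of $\bigcup H_i$. $\mathrm{VG}(\mathcal{A})_R$ is the $R$-algebra of all functions $\mathrm{ch}(\mathcal{A})\to R$; its primitive idempotents are exactly the indicator functions $1_C$, $C\in\mathrm{ch}(\mathcal{A})$. $x_i^+$ is the indicator of chambers on which $\alpha_i>0$; $\mathrm{Fil}^{-1}=0$ and $\mathrm{Fil}^k$ ($k\ge0$) is the set of $G(x_1^+,\dots,x_n^+)$ with $G\in R[z_1,\dots,z_n]$, $\deg G\le k$. $\mathrm{Aut}_{\mathsf{filt}}(\mathrm{VG}(\mathcal{A})_R)$ is the group of $R$-algebra automorphisms $\varphi$ with $\varphi(\mathrm{Fil}^k)=\mathrm{Fil}^k$ for all $k$; each $R$-algebra automorphism permutes the primitive idempotents and hence is identified with a permutation of $\mathrm{ch}(\mathcal{A})$, and conversely each permutation of $\mathrm{ch}(\mathcal{A})$ induces an $R$-algebra automorphism; $\mathrm{Aut}_{\mathsf{set}}(\mathrm{ch}(\mathcal{A}))$ is the symmetric group on $\mathrm{ch}(\mathcal{A})$. The tope graph $\mathrm{Tope}(\mathcal{A})$ has vertices $\mathrm{ch}(\mathcal{A})$, with two chambers adjacent iff exactly one hyperplane separates them; $\mathrm{Aut}_{\mathsf{graph}}$ is its automorphism group, viewed as a group of permutations of $\mathrm{ch}(\mathcal{A})$. $\mathcal{A}$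 is generic in codimension $2$ if every codimension-$2$ intersection of hyperplanes of $\mathcal{A}$ lies in exactly two hyperplanes of $\mathcal{A}$. *)

(* Defs.v *)
From HB Require Import structures.
From mathcomp Require Import all_boot all_order all_algebra.
(* The notations of mpoly clash with those of analysis. *)
From mathcomp Require Import(canonicals, coercions) mpoly.
From mathcomp Require Import all_classical all_reals all_analysis.

Set Implicit Arguments.
Unset Strict Implicit.
Unset Printing Implicit Defensive.

Import Order.TTheory GRing.Theory Num.Theory.
Import numFieldNormedType.Exports.

Local Open Scope classical_set_scope.
Local Open Scope ring_scope.

(* A central arrangement {H_1, ..., H_n} in K^l is given by linear forms
   alpha_1, ..., alpha_n, with H_i the kernel of alpha_i. *)
Section Arrangement.
Context {K : realType} {l n : nat}.
Variable alpha : 'I_n -> 'Hom('rV[K]_l, K^o).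

Definition hyperplane (i : 'I_n) : {vspace 'rV[K]_l} := lker (alpha i).

Definition is_arrangement : Prop :=
  (forall i, alpha i != 0) /\ injective hyperplane.

Definition arr_complement : set 'rV[K]_l :=
  [set x | forall i, x \notin hyperplane i].

Definition ch : set (set 'rV[K]_l) :=
  [set connected_component arr_complement x | x in arr_complement].

Definition pos_side (i : 'I_n) : set 'rV[K]_l :=
  [set x | 0 < (alpha i x : K)].

Definition neg_side (i : 'I_n) : set 'rV[K]_l :=
  [set x | (alpha i x : K) < 0].

Definition separates (i : 'I_n) (C D : ch) : Prop :=
  (val C `<=` pos_side i /\ val D `<=` neg_side i) \/
  (val C `<=` neg_side i /\ val D `<=` pos_side i).

Definition tope_adj (C D : ch) : Prop := exists! i : 'I_n, separates i C D.

Definition Aut_set : set (ch -> ch) := [set s | bijective s].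

Definition Aut_graph : set (ch -> ch) :=
  [set s | bijective s /\
           forall C D, tope_adj C D <-> tope_adj (s C) (s D)].

Definition flat (S : {set 'I_n}) : {vspace 'rV[K]_l} :=
  (\bigcap_(i in S) hyperplane i)%VS.

Definition codim (X : {vspace 'rV[K]_l}) : nat := (l - \dim X)%N.

Definition generic_codim2 : Prop :=
  forall S : {set 'I_n}, codim (flat S) = 2%N ->
    #|[set i | (flat S <= hyperplane i)%VS]%SET| = 2%N.

Section VarchenkoGelfand.
Variable R : idomainType.

(* R^o is R as a module over itself, so that VG carries both the pointwise ring
   and the pointwise R-module structure. *)
Definition VG : Type := ch -> R^o.
HB.instance Definition _ := GRing.PzRing.on VG.
HB.instance Definition _ := GRing.Lmodule.on VG.

Definition xplus (i : 'I_n) : VG := \1_[set C : ch | val C `<=` pos_side i].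

Definition idem (C : ch) : VG := \1_[set C].

(* The total degree of G is at most k iff msize G <= k.+1 (msize 0 = 0). *)
Definition Fil (k : int) : set VG :=
  match k with
  | Posz k => [set f | exists G : mpoly.mpoly n R,
      (mpoly.msize G <= k.+1)%N /\
      f = (fun C => mpoly.meval (fun i => xplus i C) G)]
  | Negz _ => [set 0]
  end.

Definition Aut_alg : set (VG -> VG) :=
  [set phi : VG -> VG | [/\ bijective phi, linear phi & GRing.monoid_morphism phi]].

Definition Aut_filt : set (VG -> VG) :=
  [set phi : VG -> VG | Aut_alg phi /\ forall k, phi @` Fil k = Fil k].

(* The permutation s of ch with phi (idem C) = idem (s C) for all C; the default
   value of xget is irrelevant when phi is an R-algebra automorphism. *)
Definition perm_of (phi : VG -> VG) : ch -> ch :=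
  fun C => xget C [set D | phi (idem C) = idem D].

End VarchenkoGelfand.
End Arrangement.

Arguments Aut_set {K l n} alpha.
Arguments Aut_graph {K l n} alpha.
Arguments VG {K l n} alpha R.
Arguments xplus {K l n} alpha R i.
Arguments Fil {K l n} alpha R k.
Arguments Aut_alg {K l n} alpha R.
Arguments Aut_filt {K l n} alpha R.

(* Main.v *)
(* A chamber is determined by its sign vector. Any two distinct chambers C and D
   are joined by a gallery crossing only hyperplanes that separate them, so the
   tope graph distance counts separating hyperplanes and a half-space consists of
   the chambers closer to one end of an edge than to the other end. A graph
   automorphism hence permutes half-spaces, that is, it sends each x_i^+ to some
   x_j^+ or 1 - x_j^+, and so preserves the degree filtration. Conversely, a
   filtered automorphism sends x_i^+ to a nonconstant idempotent of Fil^1. If A is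
   generic in codimension 2 and 2 <> 0 in R, such an idempotent is some x_j^+ or
   1 - x_j^+: an affine function c + sum_i a_i x_i^+ with two nonzero coefficients
   a_i, a_j cannot be {0,1}-valued on the four chambers around a generic point of
   the intersection of H_i and H_j. *)
Require Import Defs.
From HB Require Import structures.
From mathcomp Require Import all_boot all_order all_algebra.
From mathcomp Require Import(canonicals, coercions) mpoly.
From mathcomp Require Import all_classical all_reals all_analysis.
From mathcomp Require Import lra zify.

Set Implicit Arguments.
Unset Strict Implicit.
Unset Printing Implicit Defensive.

Import Order.TTheory GRing.Theory Num.Theory.
Import numFieldNormedType.Exports.

Local Open Scope classical_set_scope.
Local Open Scope ring_scope.

Lemma convex_comb_gt0 (K : realFieldType) (t a b : K) :
  0 <= t <= 1 -> 0 < a -> 0 < b -> 0 < (1 - t) * a + t * b.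
Proof.
move=> /andP[t0 t1] a0 b0; have [->|tn0] := eqVneq t 0.
  by rewrite subr0 mul1r mul0r addr0.
apply: ltr_wpDl; first by apply: mulr_ge0; [rewrite subr_ge0|exact: ltW].
by rewrite mulr_gt0// lt_neqAle eq_sym tn0.
Qed.

Lemma gt0_sign (K : realDomainType) (x : K) : 0 < x -> x != 0 /\ (0 < x) = true.
Proof. by move=> x0; rewrite gt_eqF. Qed.

Lemma lt0_sign (K : realDomainType) (x : K) : x < 0 -> x != 0 /\ (0 < x) = false.
Proof. by move=> x0; rewrite lt_eqF // lt_gtF. Qed.

(** * Chambers of an arrangement and their sign vectors *)

Section Chambers.
Context {K : realType} {l n : nat}.
Variable alpha : 'I_n -> 'Hom('rV[K]_l, K^o).

Local Notation A := (arr_complement alpha).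

(* [alpha i] takes values in [K^o], which does not carry the order of [K]. *)
Definition form (i : 'I_n) (x : 'rV[K]_l) : K := alpha i x.

Lemma formD i x y : form i (x + y) = form i x + form i y.
Proof. exact: linearD. Qed.

Lemma formZ i c x : form i (c *: x) = c * form i x.
Proof. exact: linearZ. Qed.

Lemma form_continuous i : continuous (form i : 'rV[K]_l -> K).
Proof.
have -> : form i =
    \sum_(j : 'I_l) (fun x => x ord0 j * form i (delta_mx 0 j)).
  apply/funext => x; rewrite {1}(row_sum_delta x) /form linear_sum fct_sumE.
  by apply: eq_bigr => j _; rewrite linearZ.
elim/big_ind: _ => [|f g cf cg x|j _ x].
- exact: (@cst_continuous _ K 0).
- exact: cvgD (cf x) (cg x).
- exact: (continuousM (@coord_continuous K 1 l ord0 j x)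
    (@cst_continuous _ K (form i _) x)).
Qed.

Lemma in_hyperplane i x : (x \in hyperplane alpha i) = (form i x == 0).
Proof. by rewrite /hyperplane memv_ker. Qed.

Lemma complementP x : A x <-> forall i, form i x != 0.
Proof. by split=> h i; have := h i; rewrite in_hyperplane. Qed.

(** The image of a component under a linear form is connected, hence an interval, and it avoids
    0. *)
Lemma component_same_side x y i : connected_component A x y ->
  (0 < form i x) = (0 < form i y).
Proof.
move=> xy; set C := connected_component A x in xy.
have CA : C `<=` A by exact: connected_component_sub.
have Ax : A x.
  by apply: contrapT => nAx; move: xy; rewrite /C connected_component_out.
have Cx : C x by exact: connected_component_refl.
have /connected_intervalP itv : connected (form i @` C).
  apply: connected_continuous_connected; first exact: component_connected.
  by apply: continuous_subspaceT => z; exact: form_continuous.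
have nz z : C z -> form i z != 0 by move/CA/complementP; exact.
have n0 : ~ (form i @` C) 0 by move=> [z Cz] /eqP; apply/negP; exact: nz.
have fx : (form i @` C) (form i x) by exists x.
have fy : (form i @` C) (form i y) by exists y.
apply/idP/idP => h; rewrite ltNge; apply/negP => h'; apply: n0.
- by apply: (itv _ _ fy fx); rewrite h' ltW.
- by apply: (itv _ _ fx fy); rewrite h' ltW.
Qed.

(** The segment from [x] to [y] stays in the complement: along it every form is a convex combination
    of two values of the same sign. *)
Lemma same_side_component x y : A x -> A y ->
  (forall i, (0 < form i x) = (0 < form i y)) -> connected_component A x y.
Proof.
move=> /complementP Ax /complementP Ay xy.
pose g (t : K) : 'rV[K]_l := x + t *: (y - x).
have gc : continuous g.
  move=> t; apply: cvgD; first exact: cvg_cst.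
  by apply: cvgZr_tmp; exact: cvg_id.
have gconn : connected (g @` `[0, 1]).
  apply: connected_continuous_connected; first exact: segment_connected.
  by apply: continuous_subspaceT => z; exact: gc.
apply: (connected_component_max _ _ gconn).
- exists 0; first by rewrite /= in_itv /= lexx ler01.
  by rewrite /g scale0r addr0.
- move=> _ [t /= + <-]; rewrite in_itv /= => /andP[t0 t1]; apply/complementP => i.
  have -> : form i (g t) = (1 - t) * form i x + t * form i y.
    by rewrite /g formD formZ -scaleN1r formD formZ; lra.
  have := xy i; have := Ax i; have := Ay i.
  case: (ltgtP (form i x) 0) => // hx; case: (ltgtP (form i y) 0) => // hy _ _ _.
  + rewrite -oppr_eq0 opprD -!mulrN gt_eqF // convex_comb_gt0 ?oppr_gt0//.
    by rewrite t0.
  + by rewrite gt_eqF // convex_comb_gt0 ?t0.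
- exists 1; first by rewrite /= in_itv /= lexx ler01.
  by rewrite /g scale1r addrCA subrr addr0.
Qed.

Definition chamber_of x (Ax : A x) : ch alpha :=
  SigSub (mem_set (ex_intro2 _ _ x Ax erefl)).

Definition pos (i : 'I_n) (C : ch alpha) : bool := `[< val C `<=` pos_side alpha i >].

Lemma pos_chamber_of x (Ax : A x) i : pos i (chamber_of Ax) = (0 < form i x).
Proof.
apply/asboolP/idP => [|h y /component_same_side xy].
  by apply; exact: connected_component_refl.
by rewrite /pos_side/= -/(form i y) -xy.
Qed.

Lemma chamber_ofP (C : ch alpha) : exists x (Ax : A x), C = chamber_of Ax.
Proof.
case: C => C hC; have [x Ax xC] := set_mem hC.
by exists x, Ax; apply: val_inj.
Qed.

Lemma pos_inj (C D : ch alpha) : (forall i, pos i C = pos i D) -> C = D.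
Proof.
have [x [Ax ->]] := chamber_ofP C; have [y [Ay ->]] := chamber_ofP D => xy.
apply: val_inj; apply: same_connected_component.
by apply: same_side_component => // i; have := xy i; rewrite !pos_chamber_of.
Qed.

Lemma separatesP i (C D : ch alpha) : separates i C D <-> pos i C != pos i D.
Proof.
(* No form vanishes on a chamber and its sign is constant there, so one point that is not on the
   positive side puts the whole chamber on the negative side. *)
have negE (E : ch alpha) : (val E `<=` neg_side alpha i) <-> ~~ pos i E.
  have [x [Ax ->]] := chamber_ofP E; rewrite pos_chamber_of -leNgt.
  split=> [|h y xy].
    by move=> /(_ _ (connected_component_refl Ax)) /ltW.
  rewrite /neg_side/= -/(form i y) ltNge le_eqVlt negb_or.
  rewrite -(component_same_side i xy) -leNgt h andbT eq_sym.
  by have /complementP := connected_component_sub xy; exact.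
have posE (E : ch alpha) : (val E `<=` pos_side alpha i) <-> pos i E.
  by split => /asboolP.
rewrite /separates !negE !posE.
by case: (pos i C) (pos i D) => [] []; split=> [[[]|[]]|] //; by [left|right].
Qed.

Lemma xplusE (R : idomainType) i (C : ch alpha) : xplus alpha R i C = (pos i C)%:R.
Proof.
by rewrite /xplus indicE; congr (nat_of_bool _)%:R.
Qed.

(** * Small perturbations and points in general position *)

Lemma perturb (p w : 'rV[K]_l) : exists2 e : K, 0 < e & forall i,
  form i p != 0 ->
  form i (p + e *: w) != 0 /\ (0 < form i (p + e *: w)) = (0 < form i p).
Proof.
(* The step [(1 + S)^-1] serves all hyperplanes at once: if [form i p] is nonzero, the ratio
   [form i w / form i p] is at most [S] in absolute value, so [form i p] outweighs the change. Zero
   denominators contribute 0 to [S]. *)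
pose S := \sum_i `|form i w / form i p|.
have S0 : 0 <= S by apply: sumr_ge0.
exists (1 + S)^-1 => [|i pi]; first by rewrite invr_gt0 ltr_wpDr.
have : `|(1 + S)^-1 * form i w| < `|form i p|.
  rewrite normrM ger0_norm ?invr_ge0 ?addr_ge0// mulrC ltr_pdivrMr ?ltr_wpDr//.
  rewrite mulrC -ltr_pdivrMr ?normr_gt0// -normf_div.
  apply: (@le_lt_trans _ _ S); last by rewrite ltrDr.
  by rewrite /S (bigD1 i)//= lerDl; apply: sumr_ge0.
rewrite formD formZ; set d := _ * form i w; rewrite ltr_norml.
case: (ltgtP (form i p) 0) pi => // hp _.
- rewrite ltr0_norm // => /andP[h1 h2].
  by apply: lt0_sign; lra.
- rewrite gtr0_norm // => /andP[h1 h2].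
  by apply: gt0_sign; lra.
Qed.

(** Take the chamber of [p + e *: w] for small positive [e]; the hypothesis moves this point off the
    hyperplanes through [p]. *)
Lemma perturbed_chamber (p w : 'rV[K]_l) :
  (forall i, form i p = 0 -> form i w != 0) ->
  exists C : ch alpha, forall i,
    pos i C = if form i p == 0 then 0 < form i w else 0 < form i p.
Proof.
move=> pw; have [e e0 he] := perturb p w.
have Ae : A (p + e *: w).
  apply/complementP => i; have [p0|/he[]//] := eqVneq (form i p) 0.
  by rewrite formD formZ p0 add0r mulf_neq0 ?pw// gt_eqF.
exists (chamber_of Ae) => i; rewrite pos_chamber_of.
have [p0|/he[]//] := eqVneq (form i p) 0.
by rewrite formD formZ p0 add0r pmulr_rgt0.
Qed.

(** Finitely many proper subspaces do not cover [U]. Hyperplanes are avoided one at a time: a point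
    on the next one is moved off it inside [U], by a step too small to land on those already
    avoided. *)
Lemma generic_point (U : {vspace 'rV[K]_l}) (P : pred 'I_n) :
  (forall i, P i -> ~~ (U <= hyperplane alpha i)%VS) ->
  exists2 u, u \in U & forall i, P i -> form i u != 0.
Proof.
move=> UP; suff [u uU hu] : exists2 u, u \in U &
    forall i, i \in enum P -> form i u != 0.
  by exists u => // i Pi; apply: hu; rewrite mem_enum.
have : {subset enum P <= P} by move=> i; rewrite mem_enum.
elim: (enum P) => [_|j s IHs sP]; first by exists 0; rewrite ?mem0v.
have [|u uU hu] := IHs; first by move=> i is_; apply: sP; rewrite inE is_ orbT.
have /subvPn[w wU] : ~~ (U <= hyperplane alpha j)%VS.
  by apply/UP/sP; rewrite mem_head.
rewrite in_hyperplane => wj; have [e e0 he] := perturb u w.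
have [uj|/eqP uj] := eqVneq (form j u) 0; last first.
  exists u => // i; rewrite inE => /orP[/eqP->|]; [exact/eqP|exact: hu].
exists (u + e *: w) => [|i]; first by rewrite rpredD ?rpredZ.
rewrite inE => /orP[/eqP->|/hu /he[]//].
by rewrite formD formZ uj add0r mulf_neq0// gt_eqF.
Qed.

(** Rank-nullity for [alpha i] on [U], whose image is a nonzero subspace of a line. *)
Lemma dim_cap_hyperplane (U : {vspace 'rV[K]_l}) i :
  ~~ (U <= hyperplane alpha i)%VS ->
  (\dim (U :&: hyperplane alpha i)).+1 = \dim U.
Proof.
move=> /subvPn[u uU ui]; rewrite -(limg_ker_dim (alpha i) U) -addn1.
congr addn; apply/eqP; rewrite eqn_leq lt0n dimv_eq0; apply/andP; split.
  apply: contra ui => /eqP aU0; rewrite memv_ker -memv0 -aU0.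
  exact: memv_img.
by apply: leq_trans (dimvS (subvf _)) _; rewrite dimvf.
Qed.

Hypothesis halpha : is_arrangement alpha.

Lemma not_fullv_sub_hyperplane i : ~~ (fullv <= hyperplane alpha i)%VS.
Proof.
apply/negP => /subvP h; have /eqP := halpha.1 i; apply; apply/lfunP => x.
by have := h x (memvf x); rewrite memv_ker lfunE => /eqP.
Qed.

(** All hyperplanes have the same dimension, so an inclusion would be an equality. *)
Lemma not_sub_hyperplane i j : i != j ->
  ~~ (hyperplane alpha i <= hyperplane alpha j)%VS.
Proof.
apply: contra => ij; apply/eqP/halpha.2/eqP; rewrite eqEdim ij/=.
have := dim_cap_hyperplane (not_fullv_sub_hyperplane i).
have := dim_cap_hyperplane (not_fullv_sub_hyperplane j).
by rewrite !capfv => <- [->].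
Qed.

Lemma transverse_direction i j : i != j ->
  exists2 v, 0 < form i v & form j v = 0.
Proof.
rewrite eq_sym => /not_sub_hyperplane/subvPn[v].
rewrite !in_hyperplane => /eqP vj; case: (ltgtP (form i v) 0) => // vi _.
- by exists (-1 *: v); rewrite formZ ?vj ?mulr0 // mulN1r oppr_gt0.
- by exists v.
Qed.

(** Step off a point of [H_i] that lies on no other hyperplane, in a direction transverse to [H_i]
    and in the opposite one. *)
Lemma adjacent_chambers i : exists C D : ch alpha,
  [/\ pos i C, ~~ pos i D & forall j, j != i -> pos j C = pos j D].
Proof.
have [|p] := @generic_point (hyperplane alpha i) (fun j => j != i).
  by move=> j ji; rewrite not_sub_hyperplane // eq_sym.
rewrite in_hyperplane => /eqP pi hp.
have /subvPn[w _] := not_fullv_sub_hyperplane i; rewrite in_hyperplane => wi.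
have side (v : 'rV[K]_l) : form i v != 0 -> exists C : ch alpha,
    pos i C = (0 < form i v) /\ forall j, j != i -> pos j C = (0 < form j p).
  move=> vi; have [|C hC] := @perturbed_chamber p v.
    by move=> j; have [-> //|/hp /eqP] := eqVneq j i.
  exists C; split=> [|j /hp]; rewrite hC; first by rewrite pi eqxx.
  by move=> /negbTE ->.
have [C [Ci hC]] := side _ wi.
have [|D [Di hD]] := side (-1 *: w); first by rewrite formZ mulN1r oppr_eq0.
have CD j : j != i -> pos j C = pos j D by move=> ji; rewrite hC ?hD.
move: Di; rewrite formZ mulN1r oppr_gt0 => Di.
have [wn|wp|w0] := ltgtP (form i w) 0; last by rewrite w0 eqxx in wi.
- exists D, C; rewrite Ci Di wn -leNgt ltW //.
  by split=> // j /CD ->.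
- by exists C, D; rewrite Ci Di wp -leNgt ltW.
Qed.

(** * Galleries: from a chamber towards another, one wall at a time *)

Lemma intermediate_chamber (x y : 'rV[K]_l) i j : A x -> A y ->
  (0 < form i x) != (0 < form i y) -> (0 < form j x) != (0 < form j y) ->
  `|form j y| * `|form i x| < `|form i y| * `|form j x| ->
  exists F : ch alpha,
    [/\ forall k, (0 < form k x) = (0 < form k y) -> pos k F = (0 < form k x),
        pos i F = (0 < form i y) & pos j F = (0 < form j x)].
Proof.
(* Since [H_i] and [H_j] both separate [x] from [y], [lt_ij] says that the segment from [x] to [y]
   meets [H_i] before [H_j]. *)
move=> /complementP Ax /complementP Ay sepi sepj lt_ij.
(* With these (mediant) weights, [a *: x + b *: y] is a multiple of a point of
   the segment [x, y] strictly between its crossings with [H_i] and [H_j]. *)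
pose a := `|form i y| + `|form j y|; pose b := `|form i x| + `|form j x|.
have a0 : 0 < a by rewrite ltr_pwDl// normr_gt0.
have b0 : 0 < b by rewrite ltr_pwDl// normr_gt0.
pose z := a *: x + b *: y.
have zE k : form k z = a * form k x + b * form k y by rewrite formD !formZ.
have zk k : (0 < form k x) = (0 < form k y) ->
    form k z != 0 /\ (0 < form k z) = (0 < form k x).
  rewrite zE; have := Ax k; have := Ay k.
  case: (ltgtP (form k x) 0) => // hx; case: (ltgtP (form k y) 0) => // hy _ _ _.
  - by apply: lt0_sign; rewrite -oppr_gt0 opprD -!mulrN addr_gt0// mulr_gt0// oppr_gt0.
  - by apply: gt0_sign; rewrite addr_gt0// mulr_gt0.
(* The point [z] may lie on further hyperplanes. Each of these separates [x] from [y], so the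
   direction [y - x] is transverse to it. *)
have [|F hF] := @perturbed_chamber z (y + -1 *: x).
  move=> k z0; rewrite formD formZ; apply/eqP => yx.
  have /zk[]: (0 < form k x) = (0 < form k y).
    by congr (0 < _); lra.
  by rewrite z0 eqxx.
(* With these weights, [form i z] and [form j z] both have as absolute value the difference of the
   two sides of [lt_ij]. *)
have zi : form i z != 0 /\ (0 < form i z) = (0 < form i y).
  rewrite zE /a /b; move: lt_ij sepi sepj (Ax i) (Ay i) (Ax j) (Ay j).
  case: (ltgtP (form i x) 0) => // xi; case: (ltgtP (form i y) 0) => // yi;
  case: (ltgtP (form j x) 0) => // xj; case: (ltgtP (form j y) 0) => // yj;
  rewrite ?(ltr0_norm xi) ?(ltr0_norm xj) ?(ltr0_norm yi) ?(ltr0_norm yj)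
     ?(gtr0_norm xi) ?(gtr0_norm xj) ?(gtr0_norm yi) ?(gtr0_norm yj)
    => h _ _ _ _ _ _; by [apply: gt0_sign; lra|apply: lt0_sign; lra].
have zj : form j z != 0 /\ (0 < form j z) = (0 < form j x).
  rewrite zE /a /b; move: lt_ij sepi sepj (Ax i) (Ay i) (Ax j) (Ay j).
  case: (ltgtP (form i x) 0) => // xi; case: (ltgtP (form i y) 0) => // yi;
  case: (ltgtP (form j x) 0) => // xj; case: (ltgtP (form j y) 0) => // yj;
  rewrite ?(ltr0_norm xi) ?(ltr0_norm xj) ?(ltr0_norm yi) ?(ltr0_norm yj)
     ?(gtr0_norm xi) ?(gtr0_norm xj) ?(gtr0_norm yi) ?(gtr0_norm yj)
    => h _ _ _ _ _ _; by [apply: gt0_sign; lra|apply: lt0_sign; lra].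
exists F; split=> [k /zk [/negbTE zk0 <-]||]; rewrite hF ?zk0 //.
- by case: zi => /negbTE -> ->.
- by case: zj => /negbTE -> ->.
Qed.

Lemma crossing_points (C D : ch alpha) i j : i != j ->
  exists x y (Ax : A x) (Ay : A y), [/\ C = chamber_of Ax, D = chamber_of Ay &
    `|form j y| * `|form i x| != `|form i y| * `|form j x|].
Proof.
move=> ij; have [x [Ax Cx]] := chamber_ofP C; have [y [Ay Dy]] := chamber_ofP D.
have [eqxy|] := eqVneq (`|form j y| * `|form i x|) (`|form i y| * `|form j x|);
  last by exists x, y, Ax, Ay.
(* If [x, y] meets [H_i] and [H_j] at the same point, move [x] parallel to [H_i]. *)
have [v vj vi] : exists2 v, 0 < form j v & form i v = 0.
  by apply: transverse_direction; rewrite eq_sym.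
have [e e0 he] := perturb x v; have /complementP nx := Ax.
have Ax' : A (x + e *: v) by apply/complementP => k; have [] := he k (nx k).
exists (x + e *: v), y, Ax', Ay; split=> //.
  rewrite Cx; apply: pos_inj => k; rewrite !pos_chamber_of.
  by have [_ ->] := he k (nx k).
have -> : form i (x + e *: v) = form i x by rewrite formD formZ vi mulr0 addr0.
have yi : `|form i y| != 0 by rewrite normr_eq0; have /complementP := Ay; exact.
(* After cancelling [form i y], it remains to see that adding [d > 0] to [form j x] without changing
   its sign changes its absolute value. *)
rewrite eqxy (inj_eq (mulfI yi)); have := he j (nx j); have := nx j.
rewrite formD formZ; have := mulr_gt0 e0 vj; set d := e * _ => d0.
case: (ltgtP (form j x) 0) => // xj _.
- case: (ltgtP (form j x + d) 0) => // h [] //= _ _.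
  by rewrite !ltr0_norm // eqr_opp lt_eqF // ltrDl.
- case: (ltgtP (form j x + d) 0) => // h [] //= _ _.
  by rewrite !gtr0_norm // lt_eqF // ltrDl.
Qed.

(** The hyperplanes separating [C] from [F] form a nonempty proper subset of those separating [C]
    from [D]: [k] is the first of [H_i], [H_j] to be crossed and [m] the other. *)
Lemma chamber_between (C D : ch alpha) i j : i != j ->
  pos i C != pos i D -> pos j C != pos j D ->
  exists F k m, [/\ pos k C != pos k F, pos m F = pos m C, pos m C != pos m D &
    forall h, pos h C != pos h F -> pos h C != pos h D].
Proof.
move=> ij; have [x [y [Ax [Ay [-> -> nexy]]]]] := crossing_points C D ij.
rewrite !pos_chamber_of => si sj.
have sub (F : ch alpha) :
    (forall k, (0 < form k x) = (0 < form k y) -> pos k F = (0 < form k x)) ->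
    forall h, pos h (chamber_of Ax) != pos h F ->
      pos h (chamber_of Ax) != pos h (chamber_of Ay).
  by move=> hF h; rewrite !pos_chamber_of; apply: contra => /eqP/hF ->.
have [lt_ij|] := boolP (`|form j y| * `|form i x| < `|form i y| * `|form j x|).
  have [F [hF Fi Fj]] := intermediate_chamber Ax Ay si sj lt_ij.
  by exists F, i, j; split; rewrite ?pos_chamber_of ?Fi//; exact: sub.
rewrite -leNgt le_eqVlt eq_sym (negbTE nexy)/= => lt_ji.
have [F [hF Fj Fi]] := intermediate_chamber Ax Ay sj si lt_ji.
by exists F, j, i; split; rewrite ?pos_chamber_of ?Fj//; exact: sub.
Qed.

(** Induction on the number of separating hyperplanes. If there are two, [D] is replaced by a
    chamber strictly between; if there is one, [D] itself is the neighbour [E]. *)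
Lemma first_wall (C D : ch alpha) : C <> D ->
  exists i E, pos i C != pos i D /\ forall j, pos j E = pos j C (+) (j == i).
Proof.
have [m] := ubnP #|[set i | pos i C != pos i D]%SET|.
elim: m D => // m IHm D; rewrite ltnS => leDm CD.
have [i si] : exists i, pos i C != pos i D.
  apply: contrapT => nosep; apply: CD; apply: pos_inj => i.
  by apply/eqP; apply: contrapT => /negP si; apply: nosep; exists i.
have [[j [ij sj]]|only_i] := pselect (exists j, i != j /\ pos j C != pos j D).
  have [F [k [h [sk hF sh sub]]]] := chamber_between ij si sj.
  have CF : C <> F by move=> eqCF; rewrite eqCF eqxx in sk.
  have [|i' [E [si' hE]]] := IHm F _ CF; last by exists i', E; split=> //; exact: sub.
  apply: leq_trans leDm; apply: proper_card; apply/properP; split.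
    by apply/fintype.subsetP => g; rewrite !inE; exact: sub.
  by exists h; rewrite inE // hF eqxx.
exists i, D; split=> // j; have [->|ji] := eqVneq j i.
  by move: si; case: (pos i C) (pos i D) => [] [].
rewrite addbF; apply/eqP; rewrite eq_sym; apply: contrapT => /negP sj.
by apply: only_i; exists j; rewrite eq_sym.
Qed.

(** * Intersections of two hyperplanes *)

Lemma codim_flat2 i j : i != j -> codim (flat alpha [set i; j]%SET) = 2%N.
Proof.
move=> ij; have -> : flat alpha [set i; j]%SET =
    (hyperplane alpha i :&: hyperplane alpha j)%VS.
  by rewrite /flat big_setU1 ?inE//= big_set1.
have := dim_cap_hyperplane (not_sub_hyperplane ij).
have := dim_cap_hyperplane (not_fullv_sub_hyperplane i).
rewrite capfv dimvf /dim /= mul1n /codim; lia.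
Qed.

(** Genericity gives a point [p] on [H_i] and [H_j] only. The four chambers touch [p], and [s]
    records the signs of the other forms at [p]. *)
Lemma chambers_around_codim2 i j : generic_codim2 alpha -> i != j ->
  exists s : 'I_n -> bool, forall a b, exists C : ch alpha,
    forall k, pos k C = if k == i then a else if k == j then b else s k.
Proof.
move=> gen ij; pose U := flat alpha [set i; j]%SET.
have UP k : (U <= hyperplane alpha k)%VS -> k \in [set i; j]%SET.
  move=> Uk; have /eqP cardS := gen _ (codim_flat2 ij).
  have sub : ([set i; j] \subset [set k | (U <= hyperplane alpha k)%VS])%SET.
    apply/fintype.subsetP => h; rewrite !inE => hij.
    by apply: (bigcapv_inf h); rewrite ?inE.
  have /eqP -> : ([set i; j] == [set k | (U <= hyperplane alpha k)%VS])%SET.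
    by rewrite eqEcard sub (eqP cardS) cards2 ij.
  by rewrite inE.
have [|p pU hp] := @generic_point U (fun k => k \notin [set i; j]%SET).
  by move=> k; apply: contra; exact: UP.
have p0 k : k \in [set i; j]%SET -> form k p = 0.
  move=> kij; apply/eqP; rewrite -in_hyperplane.
  by move: pU; apply/subvP; exact: (bigcapv_inf k).
have [u ui uj] := transverse_direction ij.
have [v vj vi] : exists2 v, 0 < form j v & form i v = 0.
  by apply: transverse_direction; rewrite eq_sym.
exists (fun k => 0 < form k p) => a b.
(* As [u] lies in [H_j] and [v] in [H_i], the signs of [form i w] and [form j w] are set
   independently by [a] and [b]. *)
pose w := (-1) ^+ (~~ a) *: u + (-1) ^+ (~~ b) *: v.
have wi : form i w = (-1) ^+ (~~ a) * form i u.
  by rewrite formD !formZ vi mulr0 addr0.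
have wj : form j w = (-1) ^+ (~~ b) * form j v.
  by rewrite formD !formZ uj mulr0 add0r.
have sgE c (z : K) : 0 < z -> (0 < (-1) ^+ (~~ c) * z) = c.
  by move=> z0; case: c; rewrite /= ?expr0 ?expr1 ?mul1r // mulN1r oppr_gt0 lt_gtF.
have [|C hC] := @perturbed_chamber p w.
  move=> k kp; have : k \in [set i; j]%SET.
    by apply: contrapT => /negP /hp; rewrite kp eqxx.
  rewrite !inE => /orP[] /eqP ->.
    by rewrite wi mulf_neq0 ?signr_eq0 ?gt_eqF.
  by rewrite wj mulf_neq0 ?signr_eq0 ?gt_eqF.
exists C => k; rewrite hC.
have [->|ki] := eqVneq k i; first by rewrite p0 ?inE ?eqxx// wi sgE.
have [->|kj] := eqVneq k j; first by rewrite p0 ?inE ?eqxx ?orbT// wj sgE.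
by rewrite (negbTE (hp k _))// !inE negb_or ki.
Qed.

End Chambers.

(** * Distances and half-spaces in the tope graph *)

Section TopeGraph.
Context {K : realType} {l n : nat}.
Variable alpha : 'I_n -> 'Hom('rV[K]_l, K^o).
Hypothesis halpha : is_arrangement alpha.

Implicit Types (C D E : ch alpha) (s t : ch alpha -> ch alpha).

Definition sepset C D : {set 'I_n} := [set i | pos i C != pos i D]%SET.

Lemma tope_adjP C D :
  tope_adj C D <-> exists i, forall j, (pos j C != pos j D) = (j == i).
Proof.
split=> [[i [/separatesP si uniq_i]]|[i hi]]; exists i.
  move=> j; apply/idP/eqP => [sj|->//].
  by apply/esym/uniq_i/separatesP.
split; first by apply/separatesP; rewrite hi eqxx.
by move=> j /separatesP; rewrite hi => /eqP.
Qed.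

Lemma card_sepset_adj C D : tope_adj C D -> #|sepset C D| = 1%N.
Proof.
move=> /tope_adjP[i hi]; apply/eqP/cards1P; exists i.
by apply/setP => j; rewrite !inE hi.
Qed.

Lemma sepset_triangle C D E : (#|sepset C E| <= #|sepset C D| + #|sepset D E|)%N.
Proof.
apply: leq_trans (leq_card_setU _ _); apply/subset_leq_card/fintype.subsetP => i.
by rewrite !inE; case: (pos i C) (pos i D) (pos i E) => [] [] [].
Qed.

(** Walk from [C] to [D], each wall bringing the distance down by one. The images form a walk of the
    same length, and the triangle inequality bounds the distance of its ends. *)
Lemma sepset_contract s C D :
  (forall C D, tope_adj C D -> tope_adj (s C) (s D)) ->
  (#|sepset (s C) (s D)| <= #|sepset C D|)%N.
Proof.
move=> adj_s; have [m] := ubnP #|sepset C D|.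
elim: m C => // m IHm C; rewrite ltnS => leCm.
have [->|CD] := pselect (C = D).
  by rewrite [X in (X <= _)%N]eq_card0 // => i; rewrite !inE eqxx.
have [i [E [si hE]]] := first_wall halpha CD.
have adjCE : tope_adj C E.
  by apply/tope_adjP; exists i => j; rewrite hE; case: (pos j C) (j == i) => [] [].
have sepED : sepset E D = (sepset C D :\ i)%SET.
  apply/setP => j; rewrite !inE hE; have [->|] := eqVneq j i; last by rewrite addbF.
  by move: si; case: (pos i C) (pos i D) => [] [].
have cardED : #|sepset C D| = (#|sepset E D|).+1.
  by rewrite sepED (cardsD1 i) inE si.
apply: leq_trans (sepset_triangle _ (s E) _) _.
rewrite (card_sepset_adj (adj_s _ _ adjCE)) cardED add1n ltnS IHm //.
by rewrite cardED in leCm.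
Qed.

Lemma Aut_graph_inv s t : cancel s t -> cancel t s ->
  Aut_graph alpha s -> Aut_graph alpha t.
Proof.
move=> st ts [_ adj_s]; split; first by exists s.
by move=> C D; apply: iff_sym; have := adj_s (t C) (t D); rewrite !ts.
Qed.

Lemma sepset_isometry s C D : Aut_graph alpha s ->
  #|sepset (s C) (s D)| = #|sepset C D|.
Proof.
move=> sG; have [[t st ts] adj_s] := sG.
have [_ adj_t] := Aut_graph_inv st ts sG.
apply/eqP; rewrite eqn_leq sepset_contract /=; last by move=> ? ? /adj_s.
by rewrite -{1}(st C) -{1}(st D) sepset_contract // => ? ? /adj_t.
Qed.

(** The two distances differ only by the count of [H_i]. This describes a half-space by distances
    alone, so that isometries carry it along. *)
Lemma halfspace_closer A B E i : (forall j, (pos j A != pos j B) = (j == i)) ->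
  (#|sepset E A| < #|sepset E B|)%N = (pos i E == pos i A).
Proof.
move=> AB; have eqAB j : j != i -> pos j A = pos j B.
  by rewrite -AB => /negPn/eqP.
have neqAB : pos i A != pos i B by rewrite AB.
have card_add C D : (forall j, j != i -> pos j C = pos j D) ->
    pos i E == pos i C -> pos i C != pos i D ->
    #|sepset E D| = (#|sepset E C|).+1.
  move=> CD /eqP EC nCD; rewrite (cardsD1 i) inE EC nCD; congr _.+1.
  apply: eq_card => j; rewrite !inE; have [->|ji] := eqVneq j i.
    by rewrite EC eqxx.
  by rewrite CD.
have [/eqP EA|EA] := eqVneq; first by rewrite (card_add A B) ?ltnSn.
apply/negbTE; rewrite -leqNgt (card_add B A) ?leqnSn//.
- by move=> j ji; rewrite eqAB.
- by move: EA neqAB; case: (pos i E) (pos i A) (pos i B) => [] [] [].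
- by rewrite eq_sym.
Qed.

(** An edge across [H_i] goes to an edge across some [H_j], and the half-spaces follow their edges;
    [b] tells whether the sides are exchanged. *)
Lemma Aut_graph_halfspace s : Aut_graph alpha s ->
  forall i, exists j b, forall C, pos j (s C) = pos i C (+) b.
Proof.
move=> sG i; have [A [B [iA iB AB]]] := adjacent_chambers halpha i.
have adjAB j : (pos j A != pos j B) = (j == i).
  have [->|/AB ->] := eqVneq j i; last by rewrite eqxx.
  by rewrite iA (negbTE iB).
have /tope_adjP[j adjs] : tope_adj (s A) (s B).
  by apply/(sG.2 A B)/tope_adjP; exists i.
exists j, (pos j (s A) (+) pos i A) => C.
have := halfspace_closer (s C) adjs; rewrite !sepset_isometry //.
rewrite (halfspace_closer _ adjAB).
by case: (pos i C) (pos i A) (pos j _) (pos j _) => [] [] [] [].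
Qed.

(** A self-map is encoded by its graph, written in sign vectors: a subset of a finite type. *)
Lemma finite_perms : finite_set [set: ch alpha -> ch alpha].
Proof.
pose signs C := [ffun i => pos i C].
have signs_inj : injective signs.
  by move=> C D CD; apply: pos_inj => i; move/ffunP: CD => /(_ i); rewrite !ffunE.
pose code s := [set p | `[< exists C, p = (signs C, signs (s C)) >]]%SET.
have code_inj : {in [set: ch alpha -> ch alpha] &, injective code}.
  move=> s t _ _ /setP st; apply/funext => C.
  have /asboolP[D [/signs_inj <- /signs_inj //]] :
      `[< exists D, (signs C, signs (s C)) = (signs D, signs (t D)) >].
    have := st (signs C, signs (s C)); rewrite !finset.in_set => <-.
    by apply/asboolP; exists C.
rewrite -(eq_finite_set (inj_card_eq code_inj)).
exact: finite_finset.
Qed.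

End TopeGraph.

(** * Algebra automorphisms as permutations of chambers *)

Section AlgebraAutomorphisms.
Context {K : realType} {l n : nat}.
Variables (alpha : 'I_n -> 'Hom('rV[K]_l, K^o)) (R : idomainType).

Implicit Types (C D : ch alpha) (f g : VG alpha R) (phi psi : VG alpha R -> VG alpha R).

Lemma VG_mulE f g C : (f * g) C = (f C : R) * (g C : R) :> R.
Proof. by []. Qed.

Lemma VG_scaleE a f C : (a *: f) C = a * (f C : R) :> R.
Proof. by []. Qed.

Lemma idem_refl C : idem R C C = 1 :> R.
Proof. by rewrite /idem indicE mem_set. Qed.

Lemma idem_neq0 C D : idem R C D != 0 :> R -> D = C.
Proof.
rewrite /idem indicE; case: (boolP (D \in _)) => [/set_mem //|_].
by rewrite eqxx.
Qed.

Lemma idem_inj : injective (@idem K l n alpha R).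
Proof.
move=> C D CD; have := idem_refl C; rewrite CD => h.
by apply: idem_neq0; rewrite h oner_neq0.
Qed.

Lemma mul_idem f C : f * idem R C = f C *: idem R C.
Proof.
apply/funext => D; rewrite VG_mulE VG_scaleE.
have [->|/idem_neq0 ->//] := eqVneq (idem R C D : R) 0.
by rewrite !mulr0.
Qed.

Lemma perm_ofP phi C D : phi (idem R C) = idem R D -> perm_of phi C = D.
Proof.
by move=> CD; apply: xget_unique => // E; rewrite /= CD => /idem_inj.
Qed.

Section OneAutomorphism.
Variable phi : VG alpha R -> VG alpha R.
Hypothesis phi_alg : Aut_alg alpha R phi.

Lemma aut_inj : injective phi.
Proof. by have [/bij_inj] := phi_alg. Qed.

Lemma autM f g : phi (f * g) = phi f * phi g.
Proof. by have [_ _ [_]] := phi_alg; exact. Qed.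

Lemma aut0 : phi 0 = 0.
Proof.
have [_ lin_phi _] := phi_alg.
have := lin_phi (-1) 0 0; rewrite !scaleN1r addNr => ->.
by rewrite addNr.
Qed.

Lemma autZ a f : phi (a *: f) = a *: phi f.
Proof.
by have [_ lin_phi _] := phi_alg; have := lin_phi a f 0; rewrite aut0 !addr0.
Qed.

(** The image of [idem R C] is a nonzero idempotent, so it equals 1 at some [D]. The preimage [f] of
    [idem R D] is then fixed by multiplication by [idem R C], hence is a multiple of it, and
    evaluation at [D] shows the factor to be 1. *)
Lemma aut_idem C : phi (idem R C) = idem R (perm_of phi C).
Proof.
suff [D phiC] : exists D, phi (idem R C) = idem R D by rewrite (perm_ofP phiC).
have [D phiCD0] : exists D, phi (idem R C) D != 0 :> R.
  apply: contrapT => noD; have : phi (idem R C) = phi 0.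
    rewrite aut0; apply/funext => D; apply/eqP; apply: contrapT => /negP hD.
    by apply: noD; exists D.
  move/aut_inj/(congr1 (fun f : VG alpha R => f C)); rewrite idem_refl.
  by move/eqP; rewrite oner_eq0.
have phiCD1 : phi (idem R C) D = 1 :> R.
  have : phi (idem R C) D * phi (idem R C) D = phi (idem R C) D :> R.
    by rewrite -VG_mulE -autM mul_idem idem_refl scale1r.
  by rewrite -[RHS]mulr1 => /(mulfI phiCD0).
exists D; have [[psi _ psiK] _ _] := phi_alg.
pose f := psi (idem R D); have phif : phi f = idem R D by rewrite /f psiK.
have fC : f = f C *: idem R C.
  rewrite -mul_idem; apply: aut_inj.
  by rewrite autM phif mulrC mul_idem phiCD1 scale1r.
have idemD : idem R D = f C *: phi (idem R C) by rewrite -autZ -fC.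
have fC1 : f C = 1 :> R.
  by have := idem_refl D; rewrite idemD VG_scaleE phiCD1 mulr1.
by rewrite idemD fC1 scale1r.
Qed.

(** Apply [phi] to [mul_idem] and evaluate at the image chamber. Thus [phi] is composition with the
    inverse of its permutation. *)
Lemma aut_eval f C : phi f (perm_of phi C) = f C.
Proof.
have := congr1 phi (mul_idem f C); rewrite autM autZ aut_idem mul_idem.
move/(congr1 (fun g : VG alpha R => g (perm_of phi C))).
by rewrite !VG_scaleE idem_refl !mulr1.
Qed.

Lemma perm_of_bij : bijective (perm_of phi).
Proof.
have inj : injective (perm_of phi).
  by move=> C D CD; apply/idem_inj/aut_inj; rewrite !aut_idem CD.
suff /choice[t tK] : forall D, exists C, perm_of phi C = D.
  by exists t => // C; apply: inj; rewrite tK.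
(* The preimage of [idem R D] is nonzero at some [C]; by [aut_eval], [idem R D] is nonzero at the
   image of [C], which is therefore [D]. *)
move=> D; have [[psi _ psiK] _ _] := phi_alg; set f := psi (idem R D).
have [C fC0] : exists C, f C != 0 :> R.
  apply: contrapT => noC; have : phi f = phi 0.
    congr phi; apply/funext => C; apply/eqP; apply: contrapT => /negP hC.
    by apply: noC; exists C.
  rewrite psiK aut0 => /(congr1 (fun f : VG alpha R => f D)); rewrite idem_refl.
  by move/eqP; rewrite oner_eq0.
by exists C; apply: idem_neq0; rewrite -(psiK (idem R D)) aut_eval.
Qed.

End OneAutomorphism.

Lemma perm_of_comp phi psi : Aut_alg alpha R phi -> Aut_alg alpha R psi ->
  perm_of (phi \o psi) = perm_of phi \o perm_of psi.
Proof.
move=> phi_alg psi_alg; apply/funext => C; apply: perm_ofP.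
by rewrite /= !aut_idem.
Qed.

Lemma perm_of_inj : {in Aut_alg alpha R &, injective (@perm_of K l n alpha R)}.
Proof.
move=> phi psi /set_mem phi_alg /set_mem psi_alg eq_perm.
have [t _ tK] := perm_of_bij phi_alg.
apply/funext => f; apply/funext => C.
by rewrite -(tK C) (aut_eval phi_alg) eq_perm (aut_eval psi_alg).
Qed.

(** Contravariant in [t]: the automorphism that belongs to a permutation is the pullback along its
    inverse. *)
Definition pullback (t : ch alpha -> ch alpha) : VG alpha R -> VG alpha R :=
  fun f => f \o t.

Lemma pullback_Aut_alg s t : cancel s t -> cancel t s -> Aut_alg alpha R (pullback t).
Proof.
move=> st ts; split=> //.
by exists (pullback s) => f; apply/funext => C; rewrite /pullback/= ?st ?ts.
Qed.

Lemma perm_of_pullback s t : cancel s t -> cancel t s -> perm_of (pullback t) = s.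
Proof.
move=> st ts; apply/funext => C; apply: perm_ofP.
rewrite /pullback /idem; apply/funext => D /=; rewrite !indicE.
congr (nat_of_bool _)%:R; apply/idP/idP => /set_mem /= h; apply/mem_set => /=.
- by rewrite -h ts.
- by rewrite h st.
Qed.

Lemma perm_of_set_bij :
  set_bij (Aut_alg alpha R) (Aut_set alpha) (@perm_of K l n alpha R).
Proof.
split; [by move=> phi; exact: perm_of_bij|exact: perm_of_inj|].
move=> s [t st ts]; exists (pullback t); first exact: pullback_Aut_alg ts.
exact: perm_of_pullback.
Qed.

End AlgebraAutomorphisms.

(** * Degree bounds for multivariate polynomials *)

Section PolynomialDegree.
Context {n : nat} {R : idomainType}.
Implicit Types p q : mpoly.mpoly n R.

Lemma msizeM_leq p q d e : (mpoly.msize p <= d.+1)%N -> (mpoly.msize q <= e.+1)%N ->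
  (mpoly.msize (p * q) <= (d + e).+1)%N.
Proof.
have [->|p0] := eqVneq p 0; first by rewrite mul0r mpoly.msize0.
have [->|q0] := eqVneq q 0; first by rewrite mulr0 mpoly.msize0.
by rewrite mpoly.msizeM //; lia.
Qed.

Lemma msizeX_leq p d : (mpoly.msize p <= 2)%N -> (mpoly.msize (p ^+ d) <= d.+1)%N.
Proof.
move=> p2; elim: d => [|d IHd]; first by rewrite expr0 mpoly.msize1.
by rewrite exprS -[d.+1]add1n msizeM_leq.
Qed.

Lemma msize_prod_leq (I : Type) (r : seq I) (p : I -> mpoly.mpoly n R) (d : I -> nat) :
  (forall i, (mpoly.msize (p i) <= (d i).+1)%N) ->
  (mpoly.msize (\prod_(i <- r) p i) <= (\sum_(i <- r) d i).+1)%N.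
Proof.
move=> pd; elim: r => [|i r IHr]; first by rewrite !big_nil mpoly.msize1.
by rewrite !big_cons msizeM_leq.
Qed.

(** Substituting polynomials of degree at most 1 turns a monomial of degree [d] into a polynomial of
    degree at most [d]. *)
Lemma msize_comp_mpoly (p : mpoly.mpoly n R) (lq : n.-tuple (mpoly.mpoly n R)) k :
  (forall i, (mpoly.msize (tnth lq i) <= 2)%N) -> (mpoly.msize p <= k)%N ->
  (mpoly.msize (mpoly.comp_mpoly lq p) <= k)%N.
Proof.
move=> lq2 pk; rewrite mpoly.comp_mpolyE.
apply: leq_trans (mpoly.msize_sum _ _ _) _; rewrite big_seq.
apply/bigmax_leqP_seq => m _ mp; apply: leq_trans (mpoly.msizeZ_le _ _) _.
have := mpoly.msize_mdeg_lt mp; rewrite mpoly.mdegE => mk.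
apply: leq_trans (leq_trans mk pk).
by apply: msize_prod_leq => i; apply: msizeX_leq.
Qed.

Lemma meval_affine p : (mpoly.msize p <= 2)%N ->
  exists (c : R) (a : 'I_n -> R), forall v, mpoly.meval v p = c + \sum_i a i * v i.
Proof.
(* Expanding over the support allows an induction on the list of monomials while the coefficients of
   [p] stay fixed. *)
move=> p2; under eq_exists do under eq_exists do
  under eq_forall do rewrite mpoly.mevalE.
have : {in mpoly.msupp p, forall m, (mpoly.mdeg m <= 1)%N}.
  by move=> m /mpoly.msize_mdeg_lt mp; rewrite -ltnS (leq_trans mp).
elim: (mpoly.msupp p : seq _) => [_|m s IHs deg_s].
  exists 0, (fun=> 0) => v; rewrite big_nil add0r big1 // => i _.
  by rewrite mul0r.
have [|c [a hca]] := IHs; first by move=> m' m's; apply: deg_s; rewrite inE m's orbT.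
have := deg_s m (mem_head _ _); rewrite leq_eqVlt => /orP[/mpoly.mdeg1P[i /eqP ->]|].
  exists c, (fun j => a j + (mpoly.mcoeff (mpoly.mnm1 i) p) *+ (j == i)) => v.
  rewrite big_cons hca; under [in RHS]eq_bigr do rewrite mulrDl.
  rewrite big_split/= addrCA; congr (_ + _); rewrite addrC; congr (_ + _).
  rewrite [RHS](bigD1 i)//= eqxx [X in _ + X]big1 ?addr0; last first.
    by move=> j /negbTE ->; rewrite mul0r.
  rewrite (bigD1 i)//= big1 ?mulr1; last first.
    by move=> j ji; rewrite mpoly.mnm1E eq_sym (negbTE ji).
  by rewrite mpoly.mnm1E eqxx.
rewrite ltnS leqn0 mpoly.mdeg_eq0 => /eqP ->.
exists (mpoly.mcoeff (mpoly.mnm0) p + c), a => v.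
rewrite big_cons hca big1 ?mulr1 ?addrA// => i _.
by rewrite mpoly.mnm0E expr0.
Qed.

End PolynomialDegree.

(** * Filtered automorphisms compared with graph automorphisms *)

Section Filtration.
Context {K : realType} {l n : nat}.
Variables (alpha : 'I_n -> 'Hom('rV[K]_l, K^o)) (R : idomainType).
Hypothesis halpha : is_arrangement alpha.

Implicit Types (C D : ch alpha) (f : VG alpha R) (s t : ch alpha -> ch alpha).

Lemma bool_natr_inj : injective (fun b : bool => b%:R : R).
Proof. by move=> [] [] // /eqP; rewrite ?oner_eq0 // eq_sym oner_eq0. Qed.

(** The pullback of each [x_i^+] is some [x_j^+] or [1 - x_j^+]; substituting these affine
    polynomials into [G] does not raise its degree. *)
Lemma Fil_pullback t :
  (forall i, exists j b, forall C, pos i (t C) = pos j C (+) b) ->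
  forall k f, Fil alpha R k f -> Fil alpha R k (pullback t f).
Proof.
move=> /choice[j /choice[b tjb]] [k|k] f /=; last by move=> ->; apply/funext.
move=> [G [Gk ->]].
pose X i : mpoly.mpoly n R := mpoly.mpolyX R (mpoly.mnm1 i).
pose lq := [tuple if b i then 1 - X (j i) else X (j i) | i < n].
have X2 i : mpoly.msize (X i) = 2%N by rewrite mpoly.msizeX mpoly.mdeg1.
exists (mpoly.comp_mpoly lq G); split.
  apply: msize_comp_mpoly => // i; rewrite tnth_mktuple.
  case: (b i); last by rewrite X2.
  apply: leq_trans (mpoly.msizeD_le _ _) _.
  by rewrite mpoly.msizeN X2 mpoly.msize1.
apply/funext => C; rewrite /pullback /= mpoly.comp_mpoly_meval.
apply: mpoly.meval_eq => i; rewrite tnth_mktuple xplusE tjb.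
case: (b i); rewrite ?mpoly.mevalB ?mpoly.meval1 mpoly.mevalXU xplusE.
  by rewrite addbT; case: (pos _ C); rewrite /= ?subrr ?subr0.
by rewrite addbF.
Qed.

Lemma Fil_pullback_graph s t : Aut_graph alpha s -> cancel t s ->
  forall k f, Fil alpha R k f -> Fil alpha R k (pullback t f).
Proof.
move=> sG ts; apply: Fil_pullback => i.
have [j [b hj]] := Aut_graph_halfspace halpha sG i; exists j, b => C.
by rewrite -[in RHS](ts C) hj -addbA addbb addbF.
Qed.

Lemma Aut_graph_sub_Aut_filt :
  Aut_graph alpha `<=` @perm_of K l n alpha R @` Aut_filt alpha R.
Proof.
move=> s sG; have [[t st ts] _] := sG; have tG := Aut_graph_inv st ts sG.
exists (pullback t); last exact: perm_of_pullback.
split; first exact: pullback_Aut_alg st ts.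
(* Pullback along [t] gives one inclusion; pullback along its inverse [s] supplies the preimages for
   the other. *)
move=> k; apply/seteqP; split=> [_ [f fk <-]|f fk].
  exact: (Fil_pullback_graph sG ts).
exists (pullback s f); first exact: (Fil_pullback_graph tG st).
by apply/funext => C; rewrite /pullback/= ts.
Qed.

Lemma xplus_Fil1 i : Fil alpha R 1 (xplus alpha R i).
Proof.
exists (mpoly.mpolyX R (mpoly.mnm1 i)); split.
  by rewrite mpoly.msizeX mpoly.mdeg1.
by apply/funext => C; rewrite mpoly.mevalXU.
Qed.

(** Such an [f] is affine in the [x_i^+] with at most one nonzero slope [a i]. The values [c] and
    [c + a i] on the two sides of [H_i] then leave only [x_i^+] and [1 - x_i^+]. *)
Lemma idempotent_Fil1 f : generic_codim2 alpha -> 2%N \notin [pchar R] ->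
  Fil alpha R 1 f -> (forall C, (f C : R) = 0 \/ (f C : R) = 1) ->
  (exists c : R, forall C, f C = c) \/
  (exists j b, forall C, f C = (pos j C (+) b)%:R :> R).
Proof.
move=> gen char2 [G [/meval_affine[c [a haG]] fG]] f01.
have two_neq0 : (2%:R : R) != 0 by move: char2; rewrite inE /=.
have fE C : f C = c + \sum_i a i * (pos i C)%:R :> R.
  by rewrite fG haG; congr (_ + _); apply: eq_bigr => i _; rewrite xplusE.
have at_most_one i j : i != j -> a i != 0 -> a j = 0.
  move=> ij ai0; apply/eqP; apply: contrapT => /negP aj0.
  (* Around a generic point of [H_i :&: H_j], [f] takes the values [v], [v + a i],
     [v + a j] and [v + a i + a j]; all lie in [{0, 1}] only if [2 = 0]. *)
  have [s hs] := chambers_around_codim2 halpha gen ij.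
  pose v := c + \sum_(k | (k != i) && (k != j)) a k * (s k)%:R.
  have v01 (p q : bool) : let x := v + a i * p%:R + a j * q%:R in x = 0 \/ x = 1.
    have [C hC] := hs p q; have := f01 C; rewrite fE.
    rewrite (bigD1 i)//= (bigD1 j) 1?eq_sym//= !hC eqxx eq_sym (negbTE ij) eqxx.
    have -> : \sum_(k | (k != i) && (k != j)) a k * (pos k C)%:R =
        \sum_(k | (k != i) && (k != j)) a k * (s k)%:R.
      by apply: eq_bigr => k /andP[/negbTE ki /negbTE kj]; rewrite hC ki kj.
    by rewrite /v -!addrA; set S := \sum_(_ < _ | _) _; rewrite (addrC S) -addrA.
  have := v01 false false; have := v01 true false; have := v01 false true.
  have := v01 true true; rewrite /= !mulr0 !mulr1 !addr0 => h11 h01 h10 h00.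
  (* If [v = 0], both slopes are 1 and the fourth value is 2; if [v = 1], both are -1 and the fourth
     value is -1. *)
  case: h00 h01 h10 h11 => ->; rewrite ?add0r.
    case=> [/eqP|->]; rewrite ?(negbTE aj0)//.
    case=> [/eqP|->]; rewrite ?(negbTE ai0)//.
    case=> /eqP; first by rewrite (negbTE two_neq0).
    by rewrite -subr_eq0 addrK oner_eq0.
  have val_m1 (x : R) : x != 0 -> 1 + x = 0 \/ 1 + x = 1 -> x = -1.
    move=> x0 [/eqP|/eqP]; first by rewrite addr_eq0 -eqr_oppLR => /eqP.
    by rewrite -subr_eq0 addrC addKr (negbTE x0).
  move=> /(val_m1 _ aj0) -> /(val_m1 _ ai0) ->; rewrite subrr add0r.
  case=> /eqP; first by rewrite oppr_eq0 oner_eq0.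
  by rewrite eq_sym -subr_eq0 opprK (negbTE two_neq0).
have [[i ai0]|a0] := pselect (exists i, a i != 0); last first.
  left; exists c => C; rewrite fE big1 ?addr0// => i _.
  suff -> : a i = 0 by rewrite mul0r.
  by apply/eqP; apply: contrapT => /negP ai0; apply: a0; exists i.
right; exists i.
have fEi C : f C = c + a i * (pos i C)%:R :> R.
  rewrite fE (bigD1 i)//= big1 ?addr0// => j ji.
  by rewrite (at_most_one i j) ?mul0r// eq_sym.
have [A [B [iA /negbTE iB _]]] := adjacent_chambers halpha i.
have := f01 A; have := f01 B; rewrite !fEi iA iB mulr0 mulr1 addr0.
case=> c01; rewrite c01 ?add0r => -[] ai.
- by rewrite ai eqxx in ai0.
- by exists false => C; rewrite fEi c01 ai add0r mul1r addbF.
- exists true => C; rewrite fEi c01 addbT.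
  have -> : a i = -1 by apply/eqP; rewrite -addr_eq0 addrC ai.
  by case: (pos i C); rewrite /= ?mulr1 ?mulr0 ?subrr ?addr0.
- move/eqP: ai; rewrite -subr_eq0 addrC addKr.
  by rewrite (negbTE ai0).
Qed.

(** The image of [x_i^+] is a 0-1 function in [Fil^1]. It is not constant, since [x_i^+] takes both
    values and [phi] only permutes chambers. *)
Lemma Aut_filt_halfspace phi : generic_codim2 alpha -> 2%N \notin [pchar R] ->
  Aut_filt alpha R phi ->
  forall i, exists j b, forall C, pos i C = pos j (perm_of phi C) (+) b.
Proof.
move=> gen char2 [phi_alg phi_Fil] i.
have [t st ts] := perm_of_bij phi_alg.
have phiE C : phi (xplus alpha R i) C = (pos i (t C))%:R :> R.
  by rewrite -{1}(ts C) aut_eval // xplusE.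
have Fil1 : Fil alpha R 1 (phi (xplus alpha R i)).
  by rewrite -(phi_Fil 1); exists (xplus alpha R i) => //; exact: xplus_Fil1.
have [C|[c phic]|[j [b hj]]] := idempotent_Fil1 gen char2 Fil1.
- by rewrite phiE; case: (pos i _); [right|left].
- have [A [B [iA iB _]]] := adjacent_chambers halpha i.
  have := phic (perm_of phi A); rewrite -(phic (perm_of phi B)).
  rewrite !phiE !st iA (negbTE iB).
  by move/eqP; rewrite oner_eq0.
- exists j, b => C; apply: bool_natr_inj.
  by rewrite -hj phiE st.
Qed.

Lemma Aut_filt_sub_Aut_graph : generic_codim2 alpha -> 2%N \notin [pchar R] ->
  @perm_of K l n alpha R @` Aut_filt alpha R `<=` Aut_graph alpha.
Proof.
move=> gen char2 _ [phi phi_filt <-]; have [phi_alg _] := phi_filt.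
split; first exact: perm_of_bij.
have /choice[p /choice[b hp]] := Aut_filt_halfspace gen char2 phi_filt.
(* If [p i = p j], the signs for [i] and [j] agree everywhere or differ everywhere, which fails on
   an edge crossing [H_i] alone. *)
have p_inj : injective p.
  move=> i j pij; apply: contrapT => /eqP ij.
  have [A [B [iA iB AB]]] := adjacent_chambers halpha i.
  have := AB j; rewrite eq_sym => /(_ ij); move: iA iB.
  rewrite (hp i A) (hp i B) (hp j A) (hp j B) pij.
  by case: (pos _ _) (pos _ _) (b i) (b j) => [] [] [] [].
have [q pq qp] := injF_bij p_inj.
have sep C D i : (pos (p i) (perm_of phi C) != pos (p i) (perm_of phi D)) =
    (pos i C != pos i D).
  by rewrite (hp i C) (hp i D); case: (pos _ _) (pos _ _) (b i) => [] [] [].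
move=> C D; split=> /tope_adjP[i hi]; apply/tope_adjP.
- by exists (p i) => j; rewrite -(qp j) sep hi (inj_eq p_inj).
- by exists (q i) => j; rewrite -sep hi -{1}(qp i) (inj_eq p_inj).
Qed.

End Filtration.

Theorem theorem3p9 (K : realType) (l n : nat)
    (alpha : 'I_n -> 'Hom('rV[K]_l, K^o)) (R : idomainType)
    (halpha : is_arrangement alpha) (hchar : 2%N \notin [pchar R]) :
  [/\ [/\ forall phi, Aut_alg alpha R phi ->
            forall C, phi (idem R C) = idem R (perm_of phi C),
          set_bij (Aut_alg alpha R) (Aut_set alpha) (@perm_of K l n alpha R)
        & forall phi psi, Aut_alg alpha R phi -> Aut_alg alpha R psi ->
            perm_of (phi \o psi) = perm_of phi \o perm_of psi],
      [/\ Aut_graph alpha `<=` @perm_of K l n alpha R @` Aut_filt alpha R,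
          @perm_of K l n alpha R @` Aut_filt alpha R `<=` Aut_set alpha
        & finite_set (Aut_filt alpha R)]
    & generic_codim2 alpha ->
      Aut_graph alpha = @perm_of K l n alpha R @` Aut_filt alpha R].
Proof.
split; first by split; [exact: aut_idem|exact: perm_of_set_bij|exact: perm_of_comp].
  have perm_sub : @perm_of K l n alpha R @` Aut_filt alpha R `<=` Aut_set alpha.
    by move=> _ [phi [phi_alg _] <-]; exact: perm_of_bij.
  split=> //; first exact: Aut_graph_sub_Aut_filt.
  (* Finiteness comes from that of the self-maps of [ch alpha], through the injective [perm_of]. *)
  have inj : {in Aut_filt alpha R &, injective (@perm_of K l n alpha R)}.
    by move=> phi psi /set_mem[? _] /set_mem[? _]; apply: perm_of_inj; exact/mem_set.
  rewrite -(eq_finite_set (inj_card_eq inj)).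
  exact: sub_finite_set (subsetT _) (finite_perms alpha).
move=> gen; apply/seteqP; split; first exact: Aut_graph_sub_Aut_filt.
exact: Aut_filt_sub_Aut_graph.
Qed.
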